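(* Let $X$ be a topological space. Two subsets of $X$ are completely separated in $X$ by $B_1(X)$ if and only if they are contained in disjoint zero sets in $Z(B_1(X))$; that is, subsets $A, B \subseteq X$ are completely separated by $B_1(X)$ if and only if there exist $f, g \in B_1(X)$ with $A \subseteq Z(f)$, $B \subseteq Z(g)$ and $Z(f) \cap Z(g) = \emptyset$.
   Context: For a topological space $X$, $B_1(X)$ denotes the set of all Baire one functions on $X$, i.e. functions $f : X \to \mathbb{R}$ that are pointwise limits on $X$ of a sequence of continuous functions $X \to \mathbb{R}$. $B_1^*(X)$ denotes the set of bounded functions in $B_1(X)$. For $f \in B_1(X)$, $Z(f) = \{x \in X : f(x) = 0\}$, and $Z(B_1(X)) = \{Z(f) : f \in B_1(X)\}$. Two subsets $A, B$ of $X$ are completely separated in $X$ by $B_1(X)$ if there exist $f \in B_1^*(X)$ and reals $r < s$ such that $f(x) = r$ for all $x \in A$, $f(x) = s$ for all $x \in B$, and $r \le f(x) \le s$ for all $x \in X$. *)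

(* Defs.v *)
From HB Require Import structures.
From mathcomp Require Import all_boot all_order all_algebra.
From mathcomp Require Import all_classical all_reals all_analysis.

Set Implicit Arguments.
Unset Strict Implicit.
Unset Printing Implicit Defensive.

Import Order.TTheory GRing.Theory Num.Theory.
Import numFieldNormedType.Exports.

Local Open Scope classical_set_scope.
Local Open Scope ring_scope.

Definition baire_one (R : realType) (X : topologicalType) : set (X -> R) :=
  [set f | exists2 u : nat -> X -> R,
     (forall n, continuous (u n)) & (forall x, u n x @[n --> \oo] --> f x)].
Arguments baire_one : clear implicits.

Definition bounded_baire_one (R : realType) (X : topologicalType) :
    set (X -> R) :=
  [set f | baire_one R X f /\ bounded_fun f].
Arguments bounded_baire_one : clear implicits.

Definition zero_set (R : realType) (X : Type) (f : X -> R) : set X :=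
  [set x | f x = 0].

Definition completely_separated_baire_one (R : realType) (X : topologicalType)
    (A B : set X) : Prop :=
  exists f : X -> R, bounded_baire_one R X f /\
    exists r s : R, [/\ r < s,
      (forall x, A x -> f x = r),
      (forall x, B x -> f x = s) &
      (forall x, r <= f x <= s)].
Arguments completely_separated_baire_one R {X} A B.

(* Main.v *)
(** If [Z(f)] and [Z(g)] are disjoint, [|f| / (|f| + |g|)] separates them. With
    [f_n -> f] and [g_n -> g] continuous, it is the pointwise limit of the
    continuous functions [|f_n| / (|f_n| + |g_n| + 1/(n+1))]; the extra term is
    needed because [f_n] and [g_n] may have common zeros. *)
Require Import Defs.
From mathcomp Require Import all_boot all_order all_algebra.
From mathcomp Require Import all_classical all_reals all_analysis.

Import Order.TTheory GRing.Theory Num.Theory.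
Import numFieldNormedType.Exports.

Local Open Scope classical_set_scope.

Lemma baire_one_subr (R : realType) (X : topologicalType) (f : X -> R) (c : R) :
  baire_one R X f -> baire_one R X (fun x => f x - c)%R.
Proof.
move=> [u uC uf]; exists (fun n x => u n x - c)%R => [n x|x].
  by apply: cvgB; [exact: uC | exact: cvg_cst].
by apply: cvgB; [exact: uf | exact: cvg_cst].
Qed.

Lemma baire_one_ratio (R : realType) (X : topologicalType) (f g : X -> R) :
  baire_one R X f -> baire_one R X g ->
  (forall x, `|f x| + `|g x| != 0)%R ->
  baire_one R X (fun x => `|f x| / (`|f x| + `|g x|))%R.
Proof.
move=> [u uC uf] [v vC vg] fg0.
exists (fun n x => `|u n x| / (`|u n x| + `|v n x| + n.+1%:R^-1))%R => [n x|x].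
  apply: cvgM; first by apply: cvg_norm; exact: uC.
  (* The term [n.+1%:R^-1] keeps the denominator positive even where [u n] and [v n] both vanish. *)
  apply: cvgV; first by rewrite gt_eqF// ltr_wpDl// addr_ge0.
  apply: cvgD; last exact: cvg_cst.
  by apply: cvgD; apply: cvg_norm; [exact: uC | exact: vC].
apply: cvgM; first by apply: cvg_norm; exact: uf.
apply: cvgV; first exact: fg0.
(* The added [0] is the limit of the perturbation [1/(n+1)]. *)
rewrite -[X in _ --> X]addr0; apply: cvgD; last exact: cvg_harmonic.
by apply: cvgD; apply: cvg_norm; [exact: uf | exact: vg].
Qed.

Theorem theorem4p8 (R : realType) (X : topologicalType) (A B : set X) :
  completely_separated_baire_one R A B <->
  exists f g : X -> R,
    [/\ baire_one R X f, baire_one R X g,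
        A `<=` zero_set f, B `<=` zero_set g &
        zero_set f `&` zero_set g = set0].
Proof.
split=> [[f [[fB1 _] [r [s [rs fA fB _]]]]]|[f [g [fB1 gB1 Af Bg fg]]]].
  (* The zero sets are the level sets of [f] at [r] and [s], disjoint because [r < s]. *)
  exists (fun x => f x - r)%R, (fun x => f x - s)%R.
  split; [exact: baire_one_subr | exact: baire_one_subr | | | ].
  - by move=> x /fA; rewrite /zero_set/= => ->; rewrite subrr.
  - by move=> x /fB; rewrite /zero_set/= => ->; rewrite subrr.
  - apply/seteqP; split=> // x [] /= /subr0_eq fr /subr0_eq fs.
    by move: rs; rewrite -fr -fs ltxx.
(* A sum of two absolute values vanishes only at a common zero, which disjointness excludes. *)
have fg0 x : (`|f x| + `|g x| != 0)%R.
  rewrite paddr_eq0// !normr_eq0; apply/negP => /andP[/eqP fx /eqP gx].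
  by have : (zero_set f `&` zero_set g) x by []; rewrite fg.
have h01 x : (0 <= `|f x| / (`|f x| + `|g x|) <= 1)%R.
  rewrite divr_ge0 ?addr_ge0//= ler_pdivrMr ?mul1r ?lerDl//.
  by rewrite lt_def fg0 addr_ge0.
exists (fun x => `|f x| / (`|f x| + `|g x|))%R; split.
  split; first exact: baire_one_ratio.
  (* [bounded_fun] asks that every large enough [M] be a bound; by [h01], any [M > 1] is one. *)
  exists 1%R; split=> // M M1 x _ /=.
  have /andP[h0 h1] := h01 x.
  by rewrite ger0_norm// (le_trans h1)// ltW.
exists 0%R, 1%R; split=> [//|x /Af fx|x /Bg gx|//].
  by rewrite fx normr0 mul0r.
(* On [B] the ratio reduces to [|f x| / |f x|], whose denominator is nonzero by [fg0]. *)
by have := fg0 x; rewrite gx normr0 addr0 => /divff.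
Qed.
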